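(* For every $p\in[1,\infty)$ there are constants $0<c_p\le C_p<\infty$ depending only on $p$ such that for all $d\in\mathbb{N}$ and all $G\in\mathcal{F}_d$, $$\frac{1}{|G\cap\mathbb{Z}^d|}\sum_{x\in G\cap\mathbb{Z}^d}|x_1|^p=\frac{1}{|G\cap\mathbb{Z}^d|}\sum_{x\in G\cap\mathbb{Z}^d}\frac{|x|_p^p}{d}$$ and $$c_p\max\big(\widetilde{\kappa}(G),\widetilde{\kappa}(G)^p\big)\le \frac{1}{|G\cap\mathbb{Z}^d|}\sum_{x\in G\cap\mathbb{Z}^d}|x_1|^p\le C_p\max\big(\widetilde{\kappa}(G),\widetilde{\kappa}(G)^p\big).$$
   Context: A convex body in $\mathbb{R}^d$ is a closed, bounded, convex set with non-empty interior. It is 1-symmetric if it is invariant under all coordinate permutations and under all coordinate sign changes $x\mapsto(\epsilon_1x_1,\dots,\epsilon_dx_d)$, $\epsilon\in\{-1,1\}^d$. $\mathcal{F}_d$ is the family of all 1-symmetric convex bodies in $\mathbb{R}^d$. For $p\in[1,\infty)$, $|x|_p=(\sum_{i=1}^d|x_i|^p)^{1/p}$. For $G\in\mathcal{F}_d$, $\widetilde{\kappa}(G)=\max_{x\in G\cap\mathbb{Z}^d}|x|_1/d$. For a finite set $A$, $|A|$ is its cardinality. $\mathbb{N}=\{1,2,\dots\}$. *)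

(* Defs.v *)
From HB Require Import structures.
From mathcomp Require Import all_boot all_order all_algebra all_fingroup.
From mathcomp Require Import finmap.
From mathcomp Require Import all_classical all_reals all_analysis.

Set Implicit Arguments.
Unset Strict Implicit.
Unset Printing Implicit Defensive.

Import Order.TTheory GRing.Theory Num.Theory.
Import numFieldNormedType.Exports.

Local Open Scope classical_set_scope.
Local Open Scope ring_scope.

Definition convex_body (R : realType) (d : nat) (G : set 'rV[R]_d) : Prop :=
  [/\ closed G, bounded_set G, convex_set G & G° !=set0].

Definition sign_change (R : realType) (d : nat) (eps : 'I_d -> bool)
    (x : 'rV[R]_d) : 'rV[R]_d :=
  \row_i ((-1) ^+ eps i * x 0 i).

Definition one_symmetric (R : realType) (d : nat) (G : set 'rV[R]_d) : Prop :=
  (forall s : 'S_d, col_perm s @` G = G) /\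
  (forall eps : 'I_d -> bool, sign_change eps @` G = G).

Definition sym_body (R : realType) (d : nat) : set (set 'rV[R]_d) :=
  [set G | convex_body G /\ one_symmetric G].

Definition pnorm (R : realType) (d : nat) (p : R) (x : 'rV[R]_d) : R :=
  (\sum_(i < d) `|x 0 i| `^ p) `^ p^-1.

(* [fset_set] is the empty finite set on infinite sets; this default value is
   never used for convex bodies, see [finite_lattice_points]. *)
Definition lattice_points (R : realType) (d : nat) (G : set 'rV[R]_d) :
    {fset 'rV[R]_d} :=
  fset_set (G `&` [set x | x \is a mxOver Num.int]).

(* Starting the maximum at 0 is harmless: the values are nonnegative. *)
Definition kappa (R : realType) (d : nat) (G : set 'rV[R]_d) : R :=
  \big[Num.max/0]_(x <- lattice_points G) (pnorm 1 x / d%:R).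

Definition lattice_avg (R : realType) (d : nat) (G : set 'rV[R]_d)
    (f : 'rV[R]_d -> R) : R :=
  (#|` lattice_points G|)%:R^-1 * \sum_(x <- lattice_points G) f x.

Lemma finite_lattice_points (R : realType) (d : nat) (G : set 'rV[R]_d) :
  bounded_set G -> finite_set (G `&` [set x | x \is a mxOver Num.int]).
Proof.
move=> /ex_strict_bound_gt0 [M /= M0 GM].
pose N := `|Num.ceil M|%N.
have MN : M <= N%:R.
  rewrite pmulrn gez0_abs; first exact: ceil_ge.
  by rewrite -(ler_int R) (le_trans (ltW M0)) ?ceil_ge.
pose f (g : {ffun 'I_d -> 'I_(N + N).+1}) : 'rV[R]_d :=
  \row_i ((g i)%:R - N%:R).
apply: (@sub_finite_set _ _ (f @` setT)); last exact/finite_image/finite_finset.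
move=> x [Gx /= /mxOverP xint].
have xN i : `|x 0 i| <= N%:R.
  apply: le_trans MN; apply: le_trans (ltW (GM _ Gx)).
  rewrite /Num.norm /= mx_normrE.
  exact: (@le_bigmax _ _ _ _ (fun ij => `|x ij.1 ij.2|) (0, i)).
exists [ffun i : 'I_d => inord `|(Num.floor (x 0 i) + N%:Z)%R|%N] => //.
apply/rowP => i; rewrite mxE ffunE.
have xiE : (Num.floor (x 0 i))%:~R = x 0 i by apply/eqP; rewrite -intrEfloor xint.
have := xN i; rewrite ler_norml => /andP[lo hi].
have lo' : 0 <= Num.floor (x 0 i) + N%:Z.
  by rewrite -(ler0z R) intrD xiE -pmulrn -lerBlDr sub0r.
rewrite inordK.
  by rewrite pmulrn gez0_abs// intrD xiE -pmulrn addrK.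
rewrite ltnS -lez_nat gez0_abs// -(ler_int R) intrD xiE -!pmulrn natrD.
by rewrite lerD2r.
Qed.

(* Main.v *)
(* Let S be the set of lattice points of G, k = kappa G * d the largest l^1 norm
   on S, and m = max 1 (kappa G). Moving absolute mass t from a coordinate i to
   a coordinate j stays in G as long as t <= |x_i| - |x_j|.

   Upper bound: with t of order 2^p m, the move that lowers a coordinate
   |x_i| >= t + 2m by t and raises a coordinate |x_j| <= 2m by t is injective.
   At least d/2 indices j are available before the move, and after it at most
   kappa d / t indices satisfy |y_j| >= t. Double counting bounds the p-th
   moment carried by the large coordinates by a quarter of the whole p-th moment
   plus an admissible term; the small coordinates are controlled by the l^1 norm.

   Lower bound: at most 4/5 of the points of S have l^1 norm below k / 80. Their
   number is at most w^-k ((1 + z) / (1 - z))^d with z = w^80, by the generating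
   function of the l^1 norm on Z^d, and S contains all the sign vectors with
   support of size k when k <= d, and the cube of side 2 (k %/ d) + 1 otherwise.
   This gives the case p = 1, from which the general case follows. *)
Require Import Defs.
From mathcomp Require Import all_boot all_order all_algebra.
From mathcomp Require Import all_fingroup finmap zify ring lra.
From mathcomp Require Import all_classical all_reals all_analysis.
Import Order.TTheory GRing.Theory Num.Theory.
Import numFieldNormedType.Exports.
Local Open Scope classical_set_scope.
Local Open Scope ring_scope.

(** * Closure properties of a 1-symmetric convex body *)

Section Geometry.
Context {R : realType} {d : nat} {G : set 'rV[R]_d}.
Hypothesis symG : sym_body G.
Implicit Types x y : 'rV[R]_d.

Lemma sign_change_mem x (eps : 'I_d -> bool) :
  G x -> G (\row_i ((-1) ^+ eps i * x 0 i)).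
Proof.
by case: symG => _ [_ sG] Gx; rewrite -(sG eps); exists x.
Qed.

Lemma col_perm_mem x (s : 'S_d) : G x -> G (col_perm s x).
Proof. by case: symG => _ [pG _] Gx; rewrite -(pG s); exists x. Qed.

Lemma convex_mem x y (l : R) :
  0 <= l <= 1 -> G x -> G y -> G (l *: x + (1 - l) *: y).
Proof.
case: symG => -[_ _ cG _] _ /andP[l0 l1] Gx Gy.
have := cG x y (Itv01 l0 l1); rewrite !inE => /(_ Gx Gy).
by rewrite /conv.
Qed.

(** Reflecting coordinate [a] stays in [G], and the new point lies on the segment from [x] to its
    reflection, with weight [(1 + c / x 0 a) / 2] on [x]. If [x 0 a = 0], then [c = 0] and nothing
    changes. *)
Lemma replace_coord_mem x a c :
  G x -> `|c| <= `|x 0 a| -> G (\row_i if i == a then c else x 0 i).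
Proof.
move=> Gx cx.
have Gf := sign_change_mem x (fun i => i == a) Gx.
have [xa0|xa0] := eqVneq (x 0 a) 0.
  move: cx; rewrite xa0 normr0 normr_le0 => /eqP->.
  rewrite (_ : \row_i _ = x)//; apply/rowP => i; rewrite mxE.
  by case: eqP => // ->.
have ca : `|c / x 0 a| <= 1.
  by rewrite normrM normfV ler_pdivrMr ?normr_gt0// mul1r.
have l01 : 0 <= (1 + c / x 0 a) / 2 <= 1 by move: ca; rewrite ler_norml; lra.
have := convex_mem _ _ _ l01 Gx Gf.
congr (G _); apply/rowP => i; rewrite !mxE.
by case: eqP => [->|_] /=; rewrite ?expr1 ?expr0; field.
Qed.

(** The coordinates of [x] are replaced one at a time; the list [s] records those already
    replaced. *)
Lemma solid x y : G x -> (forall i, `|y 0 i| <= `|x 0 i|) -> G y.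
Proof.
move=> Gx yx.
suff H (s : seq 'I_d) : G (\row_i if i \in s then y 0 i else x 0 i).
  have := H (enum 'I_d); congr (G _); apply/rowP => i.
  by rewrite !mxE mem_enum.
elim: s => [|a s IHs].
  by move: Gx; congr (G _); apply/rowP => i; rewrite mxE.
have [ins|nins] := boolP (a \in s).
  move: IHs; congr (G _); apply/rowP => i; rewrite !mxE inE.
  by case: eqP => // ->; rewrite ins.
have := replace_coord_mem _ a (y 0 a) IHs.
rewrite mxE (negbTE nins) => /(_ (yx a)).
by congr (G _); apply/rowP => i; rewrite !mxE inE; case: eqP => // ->.
Qed.

Lemma zero_mem : G 0.
Proof.
case: symG => -[_ _ _ [x /interior_subset Gx]] _.
by apply: solid Gx _ => i; rewrite mxE normr0.
Qed.

(** Up to signs, [y] is the convex combination of [|x|] and its image under the swap of [i] and [j],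
    with weight [t / (|x_i| - |x_j|)] on the image. The case [t = 0] is separate because the
    denominator may then vanish. *)
Lemma transfer_mem x y i j (t : R) : G x -> 0 <= t ->
  t <= `|x 0 i| - `|x 0 j| ->
  `|y 0 i| = `|x 0 i| - t -> `|y 0 j| = `|x 0 j| + t ->
  (forall l, l != i -> l != j -> `|y 0 l| = `|x 0 l|) -> G y.
Proof.
move=> Gx t0 tle yi yj yl.
have [tE|tn0] := eqVneq t 0.
  apply: solid Gx _ => l; have [->|li] := eqVneq l i; first by rewrite yi; lra.
  by have [->|lj] := eqVneq l j; [rewrite yj; lra|rewrite yl].
have tgt : 0 < `|x 0 i| - `|x 0 j| by move: tn0; rewrite neq_lt; lra.
pose u : 'rV[R]_d := \row_l `|x 0 l|.
have Gu : G u by apply: solid Gx _ => l; rewrite mxE normr_id.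
have Gv := col_perm_mem u (tperm i j) Gu.
have ij : i != j by apply: contraTneq tgt => ->; rewrite subrr ltxx.
pose lam := t / (`|x 0 i| - `|x 0 j|).
have l01 : 0 <= lam <= 1.
  by rewrite /lam divr_ge0 ?(ltW tgt)//= ler_pdivrMr// mul1r.
have lamE : lam * (`|x 0 i| - `|x 0 j|) = t by rewrite /lam divfK ?gt_eqF.
apply: solid (convex_mem _ _ _ l01 Gv Gu) _ => l; rewrite !mxE.
apply: le_trans (ler_norm _); rewrite le_eqVlt; apply/orP; left; apply/eqP.
have [->|li] := eqVneq l i; first by rewrite tpermL yi; lra.
have [->|lj] := eqVneq l j; first by rewrite tpermR yj; lra.
by rewrite tpermD 1?eq_sym// yl//; lra.
Qed.

End Geometry.

(** * Sums along injections and maxima over lists *)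

(** The values [f x] are distinct entries of [r], and the remaining entries contribute nonnegative
    terms. Every injective comparison of weighted sums below goes through this lemma. *)
Lemma ler_sum_inj (R : numDomainType) (T U : eqType) (s : seq T) (r : seq U)
    (P : pred T) (Q : pred U) (f : T -> U) (F : U -> R) :
  uniq s -> {in s &, forall x y, P x -> P y -> f x = f y -> x = y} ->
  {in s, forall x, P x -> f x \in r /\ Q (f x)} -> (forall y, 0 <= F y) ->
  \sum_(x <- s | P x) F (f x) <= \sum_(y <- r | Q y) F y.
Proof.
move=> us injf fr F0; rewrite -big_filter -(big_map f predT).
rewrite -[leRHS]big_filter.
have {us} us : uniq [seq f x | x <- s & P x].
  rewrite map_inj_in_uniq ?filter_uniq// => x y.
  by rewrite !mem_filter => /andP[Px xs] /andP[Py ys]; exact: injf.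
have {fr injf} : {subset [seq f x | x <- s & P x] <= [seq y <- r | Q y]}.
  move=> y /mapP[x]; rewrite mem_filter => /andP[Px xs] ->.
  by rewrite mem_filter andbC; apply/andP; exact: fr.
elim: [seq f x | x <- s & P x] us [seq y <- r | Q y] =>
    [_ t _|y t IHt /= /andP[yt ut] t' sub].
  by rewrite big_nil sumr_ge0.
have yt' : y \in t' by apply: sub; rewrite mem_head.
rewrite big_cons [leRHS](big_rem y)//= lerD2l; apply: IHt => // z zt.
have : z \in t' by apply: sub; rewrite inE zt orbT.
rewrite (perm_mem (perm_to_rem yt')) inE => /orP[/eqP zy|//].
by rewrite -zy zt in yt.
Qed.

Lemma seq_argmax (R : realDomainType) (T : eqType) (s : seq T) (F : T -> R) :
  s != [::] -> exists2 x, x \in s & {in s, forall y, F y <= F x}.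
Proof.
elim: s => // x s IHs _; have [->|/IHs[y ys ymax]] := eqVneq s [::].
  by exists x; rewrite ?mem_head// => y; rewrite inE => /eqP->.
have [xy|yx] := leP (F x) (F y).
  exists y; first by rewrite inE ys orbT.
  by move=> z; rewrite inE => /orP[/eqP->//|/ymax].
exists x; first exact: mem_head.
by move=> z; rewrite inE => /orP[/eqP->//|/ymax /le_trans->//]; exact: ltW.
Qed.

(** * Lattice points, the extremal l^1 norm and near-constant vectors *)

Section LatticePoints.
Context {R : realType} {d : nat} {G : set 'rV[R]_d}.
Hypothesis symG : sym_body G.
Implicit Types x y : 'rV[R]_d.
Local Notation S := (lattice_points G).

(** Natural numbers are used so that l^1 norms can serve as exponents and cardinalities. The
    truncation is exact on lattice points. *)
Definition nabs x (i : 'I_d) : nat := Num.truncn `|x 0 i|.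

Lemma mem_lattice x :
  reflect (G x /\ forall i, x 0 i \is a Num.int) (x \in S).
Proof.
case: symG => -[_ bG _ _] _.
rewrite in_fset_set ?inE//; last exact: finite_lattice_points.
apply: (iffP idP) => [|[Gx xint]].
  by rewrite inE => -[Gx /mxOverP xint]; split.
by rewrite inE; split=> //; apply/mxOverP => i j; rewrite ord1.
Qed.

Lemma nabsE x i : x \in S -> (nabs x i)%:R = `|x 0 i|.
Proof. by move=> /mem_lattice[_ /(_ i)/natr_norm_int]; exact: truncnK. Qed.

Lemma sum_nabsE x : x \in S -> (\sum_i nabs x i)%:R = \sum_i `|x 0 i|.
Proof. by move=> xS; rewrite natr_sum; apply: eq_bigr => i _; exact: nabsE. Qed.

Lemma pnorm1E x : pnorm 1 x = \sum_i `|x 0 i|.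
Proof.
rewrite /pnorm invr1 powRr1 ?sumr_ge0//.
by apply: eq_bigr => i _; rewrite powRr1.
Qed.

Lemma zero_lattice : 0 \in S.
Proof.
by apply/mem_lattice; split=> [|i]; [exact: zero_mem|rewrite mxE; exact: rpred0].
Qed.

Lemma card_lattice_gt0 : (0 < #|` S|)%N.
Proof. by rewrite cardfs_gt0; apply/fset0Pn; exists 0; exact: zero_lattice. Qed.

Lemma kappa_max : exists u, [/\ u \in S,
  {in S, forall x, (\sum_i nabs x i <= \sum_i nabs u i)%N} &
  kappa G = (\sum_i nabs u i)%:R / d%:R].
Proof.
have [|u uS umax] := @seq_argmax R _ S (fun x => pnorm 1 x).
  by apply: contraTneq zero_lattice => /= S0;
    rewrite -[_ \in _]/(0 \in enum_fset S) S0.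
exists u; split=> //.
  by move=> x xS; rewrite -(ler_nat R) !sum_nabsE// -!pnorm1E umax.
rewrite sum_nabsE// -pnorm1E /kappa; apply/eqP; rewrite eq_le; apply/andP; split.
  rewrite big_seq; elim/big_ind: _ => [|a b ha hb|x xS].
  - by rewrite divr_ge0// pnorm1E sumr_ge0.
  - by rewrite ge_max ha.
  - by apply: ler_wpM2r; [rewrite invr_ge0 ler0n|exact: umax].
by apply: (le_bigmax_seq 0 u xpredT).
Qed.

(* Induction on the deficit: a unit moves from a coordinate with [v i < a i] to
   one with [a j < v j]; near-constancy of [v] makes [a j < a i]. *)
Lemma dominating_point (v : 'I_d -> nat) (n : nat) (a : 'I_d -> nat) :
  G (\row_i (a i)%:R) -> (\sum_i v i <= \sum_i a i)%N ->
  (forall i j, v i <= (v j).+1)%N -> (\sum_i (v i - a i) <= n)%N ->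
  exists2 b : 'I_d -> nat, G (\row_i (b i)%:R) & forall i, (v i <= b i)%N.
Proof.
elim: n a => [|n IHn] a Ga va vv Dn.
  exists a => // i; rewrite -subn_eq0 -leqn0; apply: leq_trans Dn.
  by rewrite (bigD1 i)//= leq_addr.
have [/forallP vlea|/forallPn[j]] := boolP [forall i, v i <= a i]%N.
  by exists a.
rewrite -ltnNge => aj.
have [/existsP[i ai]|/existsPn nex] := boolP [exists i, v i < a i]%N; last first.
  suff : (\sum_i a i < \sum_i v i)%N by rewrite ltnNge va.
  rewrite (bigD1 j)//= [ltnRHS](bigD1 j)//= -addSn leq_add// leq_sum// => l _.
  by rewrite leqNgt nex.
have ij : i != j by apply: contraTneq ai => ->; rewrite -leqNgt ltnW.
have vij := vv j i.
pose a' l := if l == i then (a i).-1 else if l == j then (a j).+1 else a l.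
have a'i : a' i = (a i).-1 by rewrite /a' eqxx.
have a'j : a' j = (a j).+1 by rewrite /a' eq_sym (negbTE ij) eqxx.
have a'l l : l != i -> l != j -> a' l = a l.
  by rewrite /a' => /negbTE-> /negbTE->.
apply: (IHn a') => //.
- have nE (c : 'I_d -> nat) l : `|(\row_m (c m)%:R) 0 l : R| = (c l)%:R.
    by rewrite mxE normr_nat.
  apply: (transfer_mem symG _ _ i j 1 Ga) => //; rewrite ?nE.
  + by rewrite lerBrDl natr1 ler_nat; lia.
  + by apply/esym/eqP; rewrite a'i subr_eq natr1 prednK//; lia.
  + by rewrite a'j -natr1.
  + by move=> l li lj; rewrite !nE a'l.
- suff <- : (\sum_l a l = \sum_l a' l)%N by [].
  rewrite (bigD1 i)//= [RHS](bigD1 i)//= (bigD1 j) 1?eq_sym//=.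
  rewrite [in RHS](bigD1 j) 1?eq_sym//= a'i a'j.
  rewrite [in RHS](eq_bigr a) => [|l /andP[? ?]]; last exact: a'l.
  by lia.
- rewrite -ltnS; apply: leq_trans Dn.
  rewrite (bigD1 j)//= [ltnRHS](bigD1 j)//= -addSn leq_add ?a'j//; first by lia.
  apply: leq_sum => l lj; have [->|li] := eqVneq l i; first by rewrite a'i; lia.
  by rewrite a'l.
Qed.

(** Levelling the entries of [|x|] produces a point of [G] that dominates [v]. Indicator functions
    [v] give sign vectors in [G], and constant ones give cubes. *)
Lemma balanced_mem x (v : 'I_d -> nat) y : x \in S ->
  (\sum_i v i <= \sum_i nabs x i)%N -> (forall i j, v i <= (v j).+1)%N ->
  (forall i, `|y 0 i| <= (v i)%:R) -> G y.
Proof.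
move=> xS vx vv yv.
have Gx : G (\row_i (nabs x i)%:R).
  case/mem_lattice: (xS) => Gx _; apply: (solid symG _ _ Gx) => i.
  by rewrite mxE normr_nat nabsE.
have [b Gb vb] := dominating_point _ _ _ Gx vx vv (leqnn _).
apply: (solid symG _ _ Gb) => i; rewrite mxE normr_nat.
by apply: le_trans (yv i) _; rewrite ler_nat.
Qed.

End LatticePoints.

(** * Upper and lower bounds for counting lattice points *)

Lemma geometric_sum_le (R : realFieldType) (z : R) n : 0 <= z < 1 ->
  \sum_(i < n) z ^+ i <= (1 - z)^-1.
Proof.
move=> /andP[z0 z1]; rewrite -[leRHS]mul1r ler_pdivlMr ?subr_gt0//.
by have := subrX1 z n; have := exprn_ge0 n z0; lra.
Qed.

(** Induction through [(k + 1) C(n + 1, k + 1) = (n + 1) C(n, k)], combined with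
    [(n + 1) k <= n (k + 1)], which holds as [k <= n]. *)
Lemma expn_le_bin n k : (k <= n)%N -> (n ^ k <= 'C(n, k) * k ^ k)%N.
Proof.
elim: k n => [|k IHk] [|n]//.
rewrite ltnS => kn; have [->|k0] := posnP k; first by rewrite bin1 muln1 expn1.
have nk := IHk _ kn; rewrite expnS [(k.+1 ^ _)%N]expnS
  mulnA [('C(_, _) * _)%N]mulnC.
rewrite -mul_bin_diag -mulnA leq_mul2l /=.
rewrite -(@leq_pmul2r (k ^ k)) ?expn_gt0 ?k0//.
apply: (@leq_trans ((n * k.+1) ^ k)%N); first by rewrite -expnMn leq_exp2r//; lia.
by rewrite expnMn mulnAC leq_mul2r nk orbT.
Qed.

Section Counting.
Context {R : realType} {d : nat} {G : set 'rV[R]_d}.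
Hypothesis symG : sym_body G.
Implicit Types x y : 'rV[R]_d.
Local Notation S := (lattice_points G).

(** Each lattice point is coded by its absolute values and signs. The sum over all codes factors
    over the coordinates, and each factor is a truncation of the sum of [z^|n|] over the integers,
    which is [(1 + z) / (1 - z)]. *)
Lemma sum_pow_nabs_le (z : R) : 0 <= z < 1 ->
  \sum_(x <- S) z ^+ (\sum_i nabs x i) <= ((1 + z) / (1 - z)) ^+ d.
Proof.
move=> z01; have /andP[z0 z1] := z01.
have [u [uS umax _]] := kappa_max symG; pose N := (\sum_i nabs u i)%N.
have xN x i : x \in S -> (nabs x i <= N)%N.
  by move=> xS; apply: leq_trans (umax _ xS); rewrite (bigD1 i)//= leq_addr.
pose code x := [ffun i => (inord (nabs x i) : 'I_N.+1, x 0 i < 0)].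
(* The pair [(0, true)] is not the code of an integer, hence its weight 0. *)
pose h (nb : 'I_N.+1 * bool) :=
  if nb.2 && (nb.1 == 0%N :> nat) then 0 else z ^+ nb.1.
have h0 nb : 0 <= h nb by rewrite /h; case: ifP; rewrite ?exprn_ge0.
pose F (f : {ffun 'I_d -> 'I_N.+1 * bool}) := \prod_i h (f i).
have -> : \sum_(x <- S) z ^+ (\sum_i nabs x i) = \sum_(x <- S) F (code x).
  apply: eq_big_seq => x xS; rewrite expr_sum; apply: eq_bigr => i _.
  rewrite /h ffunE/= inordK ?ltnS ?xN//; case: ifP => // /andP[xi /eqP xi0].
  have := nabsE symG x i xS; rewrite xi0 => /esym/eqP.
  by rewrite normr_eq0 => /eqP xi1; rewrite xi1 ltxx in xi.
apply: (@le_trans _ _ (\sum_f F f)).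
  apply: (@ler_sum_inj R _ _ S _ predT predT code F) => //.
  - move=> x y xS yS _ _ /ffunP xy; apply/rowP => i.
    have := xy i; rewrite !ffunE => -[/(congr1 val)/= + sg].
    rewrite !inordK ?ltnS ?xN// => /(congr1 (fun n => n%:R : R)).
    rewrite !(nabsE symG)//; case: (ltrP (x 0 i) 0) sg => xi;
      case: (ltrP (y 0 i) 0) => // yi _.
      by rewrite !ltr0_norm// => /oppr_inj.
    by rewrite !ger0_norm.
  - by move=> x _; split=> //; rewrite mem_index_enum.
  - by move=> f; exact: prodr_ge0.
rewrite /F -(bigA_distr_bigA (fun=> h)) prodr_const card_ord.
apply: lerXn2r; rewrite ?nnegrE ?sumr_ge0//.
  by rewrite divr_ge0 ?subr_ge0 ?addr_ge0// ltW.
have -> : \sum_nb h nb = \sum_(n < N.+1) (h (n, false) + h (n, true)).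
  rewrite (eq_bigr (fun nb => h (nb.1, nb.2))) => [|[]//].
  rewrite -(pair_bigA _ (fun n b => h (n, b)))/=; apply: eq_bigr => n _.
  by rewrite big_bool addrC.
have hT : \sum_n h (n, true) = z * \sum_(n < N) z ^+ n.
  rewrite big_ord_recl {1}/h/= add0r mulr_sumr; apply: eq_bigr => n _.
  by rewrite /h/= -exprS.
rewrite big_split/= hT.
(* The two terms bound the contributions of the nonnegative and of the negative integers. *)
rewrite (_ : (1 + z) / (1 - z) = (1 - z)^-1 + z * (1 - z)^-1); last by ring.
by rewrite lerD ?ler_wpM2l ?geometric_sum_le.
Qed.

Lemma card_inj_lattice (T : finType) (A : {set T}) (f : T -> 'rV[R]_d) :
  {in A &, injective f} -> {in A, forall t, f t \in S} -> (#|A| <= #|` S|)%N.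
Proof.
move=> injf fS; rewrite cardE -(size_map f); apply: uniq_leq_size.
  by rewrite map_inj_in_uniq ?enum_uniq// => s t; rewrite !mem_enum; exact: injf.
by move=> _ /mapP[t + ->]; rewrite mem_enum; exact: fS.
Qed.

Lemma card_cube_le (L : nat) x : x \in S -> (L * d <= \sum_i nabs x i)%N ->
  ((2 * L).+1 ^ d <= #|` S|)%N.
Proof.
move=> xS Ld; pose f (g : {ffun 'I_d -> 'I_(2 * L).+1}) : 'rV[R]_d :=
  \row_i ((g i)%:R - L%:R).
rewrite -{1}(card_ord d) -[X in (X ^ _)%N]card_ord -card_ffun -cardsT.
apply: (card_inj_lattice _ _ f) => [g1 g2 _ _ /rowP g12|g _].
  apply/ffunP => i; have := g12 i; rewrite !mxE => /addIr/eqP.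
  by rewrite eqr_nat => /eqP/val_inj.
apply/(mem_lattice symG); split=> [|i]; last first.
  by rewrite mxE rpredB ?rpred_nat//.
apply: (balanced_mem symG x (fun=> L)) => // [|i].
  by rewrite sum_nat_const card_ord mulnC.
rewrite mxE ler_norml; have := ltn_ord (g i); rewrite ltnS -(ler_nat R) natrM => gi.
by have : 0 <= (g i)%:R :> R by []; lra.
Qed.

Lemma card_signed_le (k : nat) x : x \in S -> k = (\sum_i nabs x i)%N ->
  (2 ^ k * 'C(d, k) <= #|` S|)%N.
Proof.
(* A sign vector is encoded by its support, of size [k], and the subset where it equals -1. *)
move=> xS kE; pose D := [set p : {set 'I_d} * {set 'I_d} |
  (#|p.1| == k) && (p.2 \subset p.1)]%SET.
have <- : #|D| = (2 ^ k * 'C(d, k))%N.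
  rewrite -sum1_card (eq_bigl (fun p : {set 'I_d} * {set 'I_d} =>
    (#|p.1| == k) && (p.2 \subset p.1))) => [|p]; last by rewrite inE.
  rewrite -(pair_big_dep (fun A : {set 'I_d} => #|A| == k)
    (fun A C : {set 'I_d} => C \subset A) (fun _ _ => 1%N))/=.
  rewrite (eq_bigr (fun=> (2 ^ k)%N)) => [|A /eqP <-]; last first.
    by rewrite -card_powerset -sum1_card; apply: eq_bigl => C; rewrite inE.
  rewrite sum_nat_cond_const mulnC -[in RHS](card_ord d) -card_draws; congr (_ * _)%N.
pose f (p : {set 'I_d} * {set 'I_d}) : 'rV[R]_d :=
  \row_i if i \in p.2 then -1 else if i \in p.1 then 1 else 0.
have decode p i : p \in D ->
    (i \in p.1) = (f p 0 i != 0) /\ (i \in p.2) = (f p 0 i < 0).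
  rewrite inE mxE => /andP[_ /fintype.subsetP/(_ i)].
  case: (i \in p.2) => [->//|_]; first by rewrite oppr_eq0 oner_eq0 ltrN10.
  by case: (i \in p.1); rewrite ?eqxx ?ltxx ?oner_eq0 ?ltr10.
apply: (card_inj_lattice _ D f).
  move=> p q pD qD pq; have pqi i := (decode p i pD, decode q i qD).
  rewrite (surjective_pairing p) (surjective_pairing q).
  by congr pair; apply/setP => i; have [[p1 p2] [q1 q2]] := pqi i;
    rewrite ?p1 ?p2 ?q1 ?q2 pq.
move=> [A C]; rewrite inE/= => /andP[/eqP Ak CA].
apply/(mem_lattice symG); split=> [|i]; last first.
  rewrite mxE; case: ifP => _; first by rewrite rpredN rpred1.
  by case: ifP; rewrite ?rpred1 ?rpred0.
apply: (balanced_mem symG x (fun i => i \in A : nat)) => // [|i j|i].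
- by rewrite -kE -Ak -sum1_card [leqRHS]big_mkcond leq_sum // => i _; case: (i \in A).
- by case: (i \in A).
- rewrite mxE; have := fintype.subsetP CA i; case: (i \in C) => [->//|_].
    by rewrite normrN normr1.
  by case: (i \in A); rewrite ?normr1 ?normr0.
Qed.

End Counting.

(** * Scarcity of lattice points with small l^1 norm *)

(** With [w = 1 - x], the first bound keeps [w ^+ k] from being too small and the second keeps
    [w ^+ 80] away from 1. *)
Lemma bernoulli_le (R : realFieldType) (x : R) n : 0 <= x <= 1 ->
  1 - n%:R * x <= (1 - x) ^+ n /\ (1 - x) ^+ n * (1 + n%:R * x) <= 1.
Proof.
move=> /andP[x0 x1]; elim: n => [|n [IH1 IH2]].
  by rewrite expr0 mul0r; split; lra.
have n0 : 0 <= n%:R :> R by [].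
have w0 : 0 <= (1 - x) ^+ n by rewrite exprn_ge0// subr_ge0.
have nxx : 0 <= n%:R * x * x by rewrite !mulr_ge0.
rewrite exprS -natr1; split; first by nra.
apply: le_trans IH2; rewrite -mulrA (mulrC (1 - x)) -mulrA ler_wpM2l//.
by nra.
Qed.

Section FewSmall.
Context {R : realType} {d : nat} {G : set 'rV[R]_d}.
Hypothesis symG : sym_body G.
Hypothesis d_gt0 : (0 < d)%N.
Local Notation S := (lattice_points G).

(** An exponential Markov inequality: each counted point satisfies [w^k <= z^(|x|_1)] with
    [z = w^80], and the generating function bounds the sum of the right-hand sides. *)
Lemma few_small_weighted (w : R) k : 0 < w < 1 ->
  (\sum_(x <- S | (80 * (\sum_i nabs x i) <= k)%N) 1) * w ^+ k <=
  ((1 + w ^+ 80) / (1 - w ^+ 80)) ^+ d.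
Proof.
move=> /andP[w0 w1]; apply: le_trans (sum_pow_nabs_le symG (w ^+ 80) _); last first.
  by rewrite exprn_ge0 ?ltW// exprn_ilt1// ltW.
rewrite mulr_suml big_mkcond/=; apply: ler_sum => x _; case: ifP => [xk|_].
  by rewrite mul1r -exprM ler_wiXn2l ?(ltW w0) ?(ltW w1).
by rewrite !exprn_ge0// ltW.
Qed.

Lemma few_small u : u \in S -> (0 < \sum_i nabs u i)%N ->
  \sum_(x <- S | (80 * (\sum_i nabs x i) <= \sum_i nabs u i)%N) 1 <=
  4 / 5 * #|` S|%:R :> R.
Proof.
move=> uS; set k := (\sum_i nabs u i)%N => k0.
have dR : 0 < d%:R :> R by rewrite ltr0n.
have kR : 0 < k%:R :> R by rewrite ltr0n.
set n := (X in X <= _).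
have n0 : 0 <= n
  by rewrite /n big_mkcond sumr_ge0// => x _; case: ifP.
have [kd|dk] := leqP k d.
  pose K : R := k%:R / d%:R.
  have K0 : 0 < K by rewrite divr_gt0.
  have K1 : K <= 1 by rewrite ler_pdivrMr// mul1r ler_nat.
  (* Taking [w] proportional to [K] matches the lower bound [(2 / K)^k] for the number of lattice
     points. The proportion of small points is then at most [(100/97 * 3/2 * 1/2)^k = (75/97)^k]. *)
  have w01 : 0 < 2 / 3 * K < 1 by apply/andP; split; lra.
  have := few_small_weighted (2 / 3 * K) k w01; rewrite -/n.
  set z := _ ^+ 80 => nz.
  have zK : z <= K / 100.
    (* Exponent 13 already suffices: [(2/3)^13 <= 1/100], and the factor [K^13] is at most [K]. *)
    have : z <= (2 / 3 * K) ^+ 13 by rewrite ler_wiXn2l//; lra.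
    move/le_trans; apply; rewrite exprMn (exprS K).
    have K12 : K ^+ 12 <= 1 by rewrite exprn_ile1// ltW.
    have : (2 / 3) ^+ 13 <= 1 / 100 :> R by rewrite !exprS expr0; lra.
    have : 0 <= (2 / 3) ^+ 13 :> R by rewrite exprn_ge0.
    have : 0 <= K ^+ 12 by rewrite exprn_ge0// ltW.
    by nra.
  have z0 : 0 <= z by rewrite exprn_ge0//; lra.
  (* Here [(1 + z) / (1 - z) <= exp(3K/100)]; since [d K = k], the [d]-th power is at most
     [exp(3/100)^k], and [exp(3/100) <= 1 / (1 - 3/100)]. *)
  have nK : n * (2 / 3 * K) ^+ k <= (100 / 97) ^+ k.
    apply: le_trans nz _; apply: (@le_trans _ _ (expR (3 / 100 * K) ^+ d)).
      apply: lerXn2r; rewrite ?nnegrE ?expR_ge0 ?divr_ge0//; try lra.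
      by rewrite ler_pdivrMr; [have := expR_ge1Dx (3 / 100 * K); nra|lra].
    have dK : d%:R * K = k%:R by rewrite mulrC divfK ?gt_eqF.
    rewrite -expRM_natl mulrCA dK mulrC.
    rewrite expRM_natl; apply: lerXn2r; rewrite ?nnegrE ?expR_ge0//.
    have := expR_ge1Dx (- (3 / 100) : R); rewrite expRN -lef_pV2 ?posrE; last 2 first.
    - by rewrite invr_gt0 expR_gt0.
    - lra.
    by rewrite invrK (_ : (1 + - (3 / 100))^-1 = 100 / 97 :> R)//; field.
  have SK : 2 ^+ k <= #|` S|%:R * K ^+ k.
    have := card_signed_le symG k u uS erefl; rewrite -(ler_nat R) natrM natrX => SC.
    have := expn_le_bin _ _ kd; rewrite -(ler_nat R) natrM !natrX => Ck.
    rewrite /K expr_div_n mulrA ler_pdivlMr ?exprn_gt0//.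
    apply: le_trans (ler_wpM2r _ SC); rewrite ?exprn_ge0//.
    by rewrite -mulrA ler_wpM2l ?exprn_ge0.
  have Kk : 0 < K ^+ k by rewrite exprn_gt0.
  rewrite -(ler_pM2r Kk); apply: (@le_trans _ _ (4 / 5 * 2 ^+ k)); last first.
    have := ler_wpM2l (_ : 0 <= 4 / 5 :> R) SK; rewrite mulrA; apply; lra.
  have {nK} : n * K ^+ k <= (150 / 97) ^+ k.
    have q0 : 0 < (2 / 3) ^+ k :> R by rewrite exprn_gt0.
    rewrite -(ler_pM2r q0) -[leRHS]exprMn -mulrA -(exprMn _ K) (mulrC K).
    by rewrite (_ : 150 / 97 * (2 / 3) = 100 / 97 :> R)//; field.
  move/le_trans; apply; rewrite (_ : 150 / 97 = 75 / 97 * 2 :> R); last by field.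
  rewrite exprMn ler_wpM2r ?exprn_ge0//.
  by rewrite (@le_trans _ _ (75 / 97))//; [rewrite ler_iXnr//; lra|lra].
(* For [k > d] the comparison family is the cube of integer points with entries in [[-L, L]]. *)
pose L := (k %/ d)%N.
have L0 : (0 < L)%N by rewrite divn_gt0// ltnW.
have LR : 1 <= L%:R :> R by rewrite ler1n.
have Ld : (L * d <= k)%N by exact: leq_trunc_div.
have kL : (k <= 2 * L * d)%N.
  have : (k < L.+1 * d)%N by rewrite ltn_ceil.
  by move/ltnW/leq_trans; apply; rewrite leq_mul2r; apply/orP; right; lia.
(* This scale gives [w^k >= (1 - 2 L x)^d = (9/10)^d] and [z <= L / (L + 4)]. Hence [(1 + z) / (1 -
   z) <= (L + 2) / 2 <= (2 L + 1) / 2], and the proportion of small points is at most [(5/9)^d]. *)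
pose x : R := (20 * L%:R)^-1.
have xL : x * (20 * L%:R) = 1 by rewrite mulVf//; apply: lt0r_neq0; lra.
have x0 : 0 < x by rewrite invr_gt0; lra.
have x1 : x <= 1 / 20 by nra.
have x01 : 0 <= x <= 1 by apply/andP; split; lra.
have w01 : 0 < 1 - x < 1 by apply/andP; split; lra.
have := few_small_weighted (1 - x) k w01; rewrite -/n.
have [_] := bernoulli_le _ x 80 x01; set z := _ ^+ 80 => zx nz.
have z0 : 0 <= z by rewrite exprn_ge0//; lra.
have z1 : z < 1 by nra.
have zL : (1 + z) / (1 - z) <= (2 * L).+1%:R / 2.
  rewrite ler_pdivrMr ?subr_gt0// -natr1 natrM.
  have : z * (L%:R + 4) <= L%:R.
    rewrite (_ : L%:R + 4 = L%:R * (1 + 80 * x)); last by nra.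
    by rewrite mulrCA ler_piMr//; lra.
  by nra.
have wk : (9 / 10) ^+ d <= (1 - x) ^+ k.
  apply: (@le_trans _ _ ((1 - x) ^+ (2 * L * d))); last first.
    by rewrite ler_wiXn2l//; lra.
  rewrite exprM; apply: lerXn2r; rewrite ?nnegrE ?exprn_ge0//; try lra.
  by have [+ _] := bernoulli_le _ x (2 * L) x01; rewrite natrM; nra.
have nL : n * (9 / 10) ^+ d <= ((2 * L).+1%:R / 2) ^+ d.
  apply: le_trans (ler_wpM2l n0 wk) _; apply: le_trans nz _.
  by apply: lerXn2r; rewrite ?nnegrE ?divr_ge0//; lra.
have {}nL : n <= (5 / 9) ^+ d * #|` S|%:R.
  have : n <= (5 / 9 * (2 * L).+1%:R) ^+ d.
    rewrite -(@ler_pM2r _ ((9 / 10) ^+ d)) ?exprn_gt0//.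
    rewrite -exprMn; apply: le_trans nL _; rewrite le_eqVlt; apply/orP; left.
    by apply/eqP; congr (_ ^+ _); field.
  move/le_trans; apply; rewrite exprMn ler_wpM2l ?exprn_ge0// -natrX ler_nat.
  exact: (card_cube_le symG L u).
apply: le_trans nL _; rewrite ler_wpM2r//.
by rewrite (@le_trans _ _ (5 / 9))//; [rewrite ler_iXnr//; lra|lra].
Qed.

End FewSmall.

(** * Moments of the coordinates *)

Lemma powR_addl_le (R : realType) (p a b : R) : 0 <= p -> 0 <= a -> 0 <= b ->
  (a + b) `^ p <= 2 `^ p * (a `^ p + b `^ p).
Proof.
move=> p0; wlog ba : a b / b <= a => [hw|] a0 b0.
  have [/hw|/ltW/hw] := leP b a; first exact.
  by rewrite addrC (addrC (b `^ p)); exact.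
apply: (@le_trans _ _ ((2 * a) `^ p)).
  by apply: ge0_ler_powR; rewrite // ?nnegrE ?addr_ge0 ?mulr_ge0//; lra.
by rewrite powRM// ler_wpM2l ?powR_ge0// lerDl powR_ge0.
Qed.

(** Changes the absolute value by [s] along the sign of [y], with 0 counted as positive; a negative
    [s] moves towards 0. *)
Definition shift_norm (R : numDomainType) (s y : R) : R :=
  if y < 0 then y - s else y + s.

Lemma norm_shift_norm (R : realDomainType) (s y : R) :
  0 <= `|y| + s -> `|shift_norm R s y| = `|y| + s.
Proof.
rewrite /shift_norm; case: ltrP => y0.
  by rewrite (ltr0_norm y0) => ys; rewrite ler0_norm; lra.
by rewrite (ger0_norm y0) => ys; rewrite ger0_norm.
Qed.

(** Strict positivity preserves the sign, so that opposite values cannot both be sent to 0. *)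
Lemma shift_norm_inj (R : realDomainType) (s y z : R) :
  0 < `|y| + s -> 0 < `|z| + s ->
  shift_norm R s y = shift_norm R s z -> y = z.
Proof.
rewrite /shift_norm; case: (ltrP y 0) => y0; case: (ltrP z 0) => z0;
  rewrite ?(ltr0_norm y0) ?(ltr0_norm z0) ?(ger0_norm y0) ?(ger0_norm z0); lra.
Qed.

Section Moments.
Context {R : realType} {d : nat} {G : set 'rV[R]_d}.
Hypothesis symG : sym_body G.
Hypothesis d_gt0 : (0 < d)%N.
Implicit Types x y : 'rV[R]_d.
Local Notation S := (lattice_points G).
Local Notation K := (kappa G).

Lemma dR_gt0 : 0 < d%:R :> R. Proof. by rewrite ltr0n. Qed.

Lemma kappa_ge0 : 0 <= K.
Proof. by have [u [_ _ ->]] := kappa_max symG; rewrite divr_ge0. Qed.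

Lemma sum_norm_le x : x \in S -> \sum_i `|x 0 i| <= K * d%:R.
Proof.
have [u [_ umax ->]] := kappa_max symG => xS.
by rewrite divfK ?gt_eqF ?dR_gt0// -(sum_nabsE symG x xS) ler_nat umax.
Qed.

(** Swapping coordinates [i] and [j] maps [S] injectively into itself; one inequality suffices by
    symmetry. *)
Lemma sum_coord_perm (f : R -> R) i j : (forall r, 0 <= f r) ->
  \sum_(x <- S) f (x 0 i) = \sum_(x <- S) f (x 0 j).
Proof.
move=> f0; wlog suff le_ij : i j /
    \sum_(x <- S) f (x 0 i) <= \sum_(x <- S) f (x 0 j).
  by apply: le_anti; rewrite !le_ij.
rewrite (eq_bigr (fun x => f ((col_perm (tperm i j) x) 0 j))) => [|x _]; last first.
  by rewrite mxE tpermR.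
apply: (@ler_sum_inj R _ _ S S predT predT _ (fun y => f (y 0 j))) => //.
  move=> x y _ _ _ _ /rowP xy; apply/rowP => l.
  by have := xy (tperm i j l); rewrite !mxE tpermK.
move=> x /(mem_lattice symG)[Gx xint] _; split=> //.
apply/(mem_lattice symG); split=> [|l]; first exact: (col_perm_mem symG).
by rewrite mxE.
Qed.

Lemma sum_coord (f : R -> R) i : (forall r, 0 <= f r) ->
  \sum_(x <- S) \sum_j f (x 0 j) = d%:R * \sum_(x <- S) f (x 0 i).
Proof.
move=> f0; rewrite exchange_big/= (eq_bigr (fun=> \sum_(x <- S) f (x 0 i))).
  by rewrite sumr_const card_ord mulr_natl.
by move=> j _; exact: sum_coord_perm.
Qed.

(** At least a fifth of the lattice points have l^1 norm above [k / 80], and [400 = 5 * 80]. *)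
Lemma sum_l1_ge : K * d%:R * #|` S|%:R / 400 <= \sum_(x <- S) \sum_i `|x 0 i|.
Proof.
have [u [uS umax KE]] := kappa_max symG.
have kE : K * d%:R = (\sum_i nabs u i)%:R by rewrite KE divfK ?gt_eqF ?dR_gt0.
rewrite kE; set k := (\sum_i _)%N in kE *.
have [->|k0] := posnP k.
  by rewrite !mul0r sumr_ge0// => x _; rewrite sumr_ge0.
have := few_small symG d_gt0 u uS k0; rewrite -/k => few.
have cardE : \sum_(x <- S | (80 * (\sum_i nabs x i) <= k)%N) 1 +
    \sum_(x <- S | ~~ (80 * (\sum_i nabs x i) <= k)%N) 1 = #|` S|%:R :> R.
  rewrite -(bigID (fun x => (80 * (\sum_i nabs x i) <= k)%N) predT)/=.
  by rewrite big_const_seq count_predT iter_addr_0.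
apply: (@le_trans _ _
  (\sum_(x <- S | ~~ (80 * (\sum_i nabs x i) <= k)%N) (k%:R / 80))).
  rewrite (eq_bigr (fun=> k%:R / 80 * 1)) => [|x _]; last by rewrite mulr1.
  rewrite -mulr_sumr; have k0' : 0 <= k%:R :> R by [].
  by nra.
rewrite [leRHS](bigID (fun x => (80 * (\sum_i nabs x i) <= k)%N))/=.
rewrite -[leLHS]add0r lerD//; first by rewrite sumr_ge0// => x _; rewrite sumr_ge0.
rewrite big_seq_cond [leRHS]big_seq_cond; apply: ler_sum => x /andP[xS].
rewrite -ltnNge -(sum_nabsE symG x xS) -(ltr_nat R) natrM => /ltW.
by rewrite ler_pdivrMr// mulrC.
Qed.

Variable p : R.
Hypothesis p_ge1 : 1 <= p.

Let p_ge0 : 0 <= p. Proof. exact: le_trans p_ge1. Qed.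
Let p_gt0 : 0 < p. Proof. exact: lt_le_trans p_ge1. Qed.
Let p1_ge0 : 0 <= p - 1. Proof. by rewrite subr_ge0. Qed.

Local Notation Mp := (\sum_(x <- S) \sum_i `|x 0 i| `^ p).

(** Sums along the injective move [phi] of mass [t] from [i] to [j]. Integrality of [t] keeps the
    image in the lattice, and [T > 0] keeps [|x_i| - t] positive, so the sign of [x_i] can be
    recovered. *)
Lemma exchange_pair (i j : 'I_d) (t T : R) : t \is a Num.int ->
  0 < t -> 0 < T ->
  \sum_(x <- S | (t + T <= `|x 0 i|) && (`|x 0 j| <= T)) `|x 0 i| `^ p <=
  \sum_(y <- S | t <= `|y 0 j|) (`|y 0 i| + t) `^ p.
Proof.
move=> tint t0 T0; have [ij|ij] := eqVneq i j.
  rewrite -ij big_pred0 => [|x]; first by rewrite sumr_ge0// => *; exact: powR_ge0.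
  by apply/negbTE/negP => /andP[]; lra.
pose phi x : 'rV[R]_d := \row_l
  (if l == i then shift_norm _ (- t) (x 0 l)
   else if l == j then shift_norm _ t (x 0 l) else x 0 l).
have phii x : phi x 0 i = shift_norm _ (- t) (x 0 i) by rewrite mxE eqxx.
have phij x : phi x 0 j = shift_norm _ t (x 0 j).
  by rewrite mxE eq_sym (negbTE ij) eqxx.
have phil x l : l != i -> l != j -> phi x 0 l = x 0 l.
  by rewrite mxE => /negbTE-> /negbTE->.
rewrite (eq_bigr (fun x => (`|phi x 0 i| + t) `^ p)) => [|x /andP[xi xj]]; last first.
  by rewrite phii norm_shift_norm ?subrK//; lra.
apply: (@ler_sum_inj R _ _ S S _ (fun y => t <= `|y 0 j|) phi
  (fun y => (`|y 0 i| + t) `^ p)) => //.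
- move=> x y _ _ /andP[xi xj] /andP[yi yj] /rowP xy; apply/rowP => l.
  have [->|li] := eqVneq l i.
    by have := xy i; rewrite !phii => /shift_norm_inj; apply; lra.
  have [->|lj] := eqVneq l j; last by have := xy l; rewrite !phil.
  by have := xy j; rewrite !phij => /shift_norm_inj; apply; rewrite ltr_wpDl.
- move=> x xS /andP[xi xj]; have /(mem_lattice symG)[Gx xint] := xS.
  have xj0 := normr_ge0 (x 0 j).
  split; last by rewrite phij norm_shift_norm; lra.
  apply/(mem_lattice symG); split=> [|l]; last first.
    rewrite mxE /shift_norm; do 4?[case: ifP => _];
    by rewrite ?rpredD ?rpredB ?rpredN ?opprK ?xint.
  apply: (transfer_mem symG x _ i j t Gx) => //.
  + exact: ltW.
  + lra.
  + by rewrite phii norm_shift_norm//; lra.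
  + by rewrite phij norm_shift_norm//; lra.
  + by move=> l li lj; rewrite phil.
- by move=> y; exact: powR_ge0.
Qed.

(** Markov's inequality: at most [K d / T <= d / 2] coordinates exceed [T]. *)
Lemma many_small_coords x (T : R) : x \in S -> 0 < T -> 2 * K <= T ->
  d%:R / 2 <= \sum_(j | `|x 0 j| <= T) 1 :> R.
Proof.
move=> xS T0 KT; rewrite -(ler_pM2l T0).
have : T * d%:R <= T * (\sum_(j | `|x 0 j| <= T) 1) + \sum_j `|x 0 j|.
  rewrite mulr_sumr big_mkcond -big_split/= mulr_natr -[X in _ *+ X](card_ord d).
  rewrite -sumr_const; apply: ler_sum => j _; have := normr_ge0 (x 0 j).
  by case: (leP `|x 0 j| T) => ? ?; lra.
have := sum_norm_le x xS; have := ler_wpM2r (ltW dR_gt0) KT.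
by lra.
Qed.

Lemma few_large_coords x (t : R) : x \in S -> 0 < t ->
  \sum_(j | t <= `|x 0 j|) 1 <= K * d%:R / t.
Proof.
move=> xS t0; rewrite ler_pdivlMr// mulr_suml; apply: le_trans (sum_norm_le x xS).
rewrite big_mkcond; apply: ler_sum => j _.
by case: ifP => // tj; rewrite mul1r.
Qed.

(** The exchange inequality is summed over all pairs [(i, j)]. On the left each large coordinate has
    at least [d / 2] partners, on the right at most [K d / t]; the quotient is [2 K / t]. *)
Lemma large_part_le (t T : R) : t \is a Num.int -> 0 < t -> 0 < T -> 2 * K <= T ->
  \sum_(x <- S) \sum_(i | t + T <= `|x 0 i|) `|x 0 i| `^ p <=
  2 * K / t * \sum_(x <- S) \sum_i (`|x 0 i| + t) `^ p.
Proof.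
move=> tint t0 T0 KT.
have dR := dR_gt0; rewrite -(@ler_pM2l _ (d%:R / 2)) ?divr_gt0//.
pose lhs := \sum_i \sum_j
  \sum_(x <- S | (t + T <= `|x 0 i|) && (`|x 0 j| <= T)) `|x 0 i| `^ p.
pose rhs := \sum_i \sum_(j : 'I_d)
  \sum_(y <- S | t <= `|y 0 j|) (`|y 0 i| + t) `^ p.
have lr : lhs <= rhs.
  by apply: ler_sum => i _; apply: ler_sum => j _; exact: exchange_pair.
apply: le_trans (le_trans _ lr) _.
  rewrite /lhs mulr_sumr.
  under [leRHS]eq_bigr do rewrite (exchange_big_dep predT)//=.
  rewrite exchange_big/= big_seq [leRHS]big_seq; apply: ler_sum => x xS.
  rewrite mulr_sumr big_mkcond; apply: ler_sum => i _.
  case: ifP => xi /=; last by rewrite big_pred0.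
  rewrite (eq_bigr (fun=> `|x 0 i| `^ p * 1)) => [|j _]; last by rewrite mulr1.
  by rewrite -mulr_sumr mulrC ler_wpM2l ?powR_ge0// many_small_coords.
rewrite /rhs.
under [leLHS]eq_bigr do rewrite (exchange_big_dep predT)//=.
rewrite exchange_big/= mulr_sumr mulr_sumr big_seq [leRHS]big_seq.
apply: ler_sum => x xS.
rewrite !mulr_sumr; apply: ler_sum => i _.
rewrite (eq_bigr (fun=> (`|x 0 i| + t) `^ p * 1)) => [|j _]; last by rewrite mulr1.
rewrite -mulr_sumr mulrA mulrC ler_wpM2r ?powR_ge0//.
by apply: le_trans (few_large_coords x t xS t0) _; lra.
Qed.

(** One factor [|x_i|] is kept for the l^1 bound, and the other factor [|x_i|^(p-1)] is at most
    [T^(p-1)]. *)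
Lemma small_part_le (T : R) : 0 < T ->
  \sum_(x <- S) \sum_(i | `|x 0 i| < T) `|x 0 i| `^ p <=
  T `^ (p - 1) * (K * d%:R * #|` S|%:R).
Proof.
move=> T0; apply: (@le_trans _ _ (\sum_(x <- S) T `^ (p - 1) * (K * d%:R))).
  rewrite big_seq [leRHS]big_seq; apply: ler_sum => x xS.
  apply: le_trans (ler_wpM2l (powR_ge0 _ _) (sum_norm_le x xS)).
  rewrite mulr_sumr big_mkcond; apply: ler_sum => i _.
  case: ifP => [xi|_]; last by rewrite mulr_ge0 ?powR_ge0.
  rewrite -(mulr_powRB1 (normr_ge0 _) p_gt0) mulrC ler_wpM2r//.
  by apply: ge0_ler_powR; rewrite // ?nnegrE ltW.
by rewrite big_const_seq count_predT iter_addr_0 -[leLHS]mulr_natr -!mulrA.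
Qed.

Lemma moment_le : Mp <= 4 * 2 `^ p * (11 * 2 `^ p) `^ (p - 1) *
  Num.max K (K `^ p) * (d%:R * #|` S|%:R).
Proof.
set c2 : R := 2 `^ p; have K0 := kappa_ge0; pose m : R := Num.max 1 K.
have m1 : 1 <= m by rewrite le_max lexx.
have Km : K <= m by rewrite le_max lexx orbT.
have c21 : 1 <= c2 by rewrite -(powRr0 2) ler_powR//; lra.
have cm : m <= c2 * m by rewrite ler_peMl//; lra.
(* The factor 8 makes [2 K / t * c2 <= 1/4], so the [Mp] term produced by the large part can be
   absorbed. Rounding up to an integer costs at most 1, hence at most [c2 * m]. *)
pose t : R := (Num.truncn (8 * c2 * m)).+1%:R.
have tint : t \is a Num.int by rewrite rpred_nat.
have [t_lo t_hi] : 8 * c2 * m < t /\ t <= 9 * c2 * m.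
  have cm0 : 0 <= 8 * c2 * m by rewrite !mulr_ge0//; lra.
  have /andP[lo hi] := truncn_itv cm0; split=> //.
  by rewrite /t -natr1; lra.
have t0 : 0 < t by lra.
have Q0 : 0 <= (11 * c2 * m) `^ (p - 1) by exact: powR_ge0.
set Q := (11 * c2 * m) `^ (p - 1) in Q0.
have Qt r : 0 <= r -> r <= 11 * c2 * m -> r `^ (p - 1) <= Q.
  by move=> r0 rm; apply: ge0_ler_powR; rewrite // nnegrE; lra.
(* The choice of [m] gives [K m^(p-1) <= max(K, K^p)]. The constant 11 in [Q] covers
   [t + 2m <= 9 c2 m + 2 c2 m]. *)
have KQ : K * Q <= (11 * c2) `^ (p - 1) * Num.max K (K `^ p).
  rewrite /Q powRM; [|lra|lra].
  rewrite mulrCA ler_wpM2l ?powR_ge0// /m; case: (leP K 1) => K1.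
    by rewrite powR1 mulr1 le_max lexx.
  by rewrite mulr_powRB1// le_max lexx orbT.
set N := d%:R * #|` S|%:R.
have N0 : 0 <= N by rewrite mulr_ge0.
have M0 : 0 <= Mp by apply: sumr_ge0 => x _; apply: sumr_ge0 => i _; exact: powR_ge0.
have shift : \sum_(x <- S) \sum_i (`|x 0 i| + t) `^ p <= c2 * (Mp + N * t `^ p).
  have -> : N * t `^ p = \sum_(x <- S) \sum_(i < d) t `^ p.
    rewrite big_const_seq count_predT iter_addr_0 sumr_const card_ord.
    by rewrite -mulrnA /N -natrM mulr_natl.
  rewrite -big_split /= mulr_sumr; apply: ler_sum => x _.
  rewrite -big_split /= mulr_sumr; apply: ler_sum => i _.
  by apply: powR_addl_le => //; exact: ltW.
have Kt : K / t <= (8 * c2)^-1.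
  rewrite ler_pdivrMr// mulrC ler_pdivlMr; last lra.
  have Kcm : K * c2 <= c2 * m by rewrite mulrC ler_wpM2l//; lra.
  by lra.
have KtN : K / t * (N * t `^ p) <= N * (K * Q).
  rewrite -(mulr_powRB1 (ltW t0) p_gt0).
  rewrite (_ : _ * _ = N * (K * t `^ (p - 1))); last by field; rewrite gt_eqF.
  by rewrite !ler_wpM2l// Qt//; lra.
have T0 : 0 < 2 * m by lra.
have KT : 2 * K <= 2 * m by rewrite ler_wpM2l.
have := large_part_le t (2 * m) tint t0 T0 KT.
have := small_part_le (t + 2 * m) (addr_gt0 t0 T0).
have split_Mp : Mp = \sum_(x <- S) \sum_(i | t + 2 * m <= `|x 0 i|) `|x 0 i| `^ p +
    \sum_(x <- S) \sum_(i | `|x 0 i| < t + 2 * m) `|x 0 i| `^ p.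
  rewrite -big_split/=; apply: eq_bigr => x _.
  rewrite (bigID (fun i => t + 2 * m <= `|x 0 i|))/=; congr (_ + _).
  by apply: eq_bigl => i; rewrite -ltNge.
set A := \sum_(x <- S) \sum_(i | t + _ <= _) _ in split_Mp *.
set B := \sum_(x <- S) \sum_(i | _ < _) _ in split_Mp * => small large.
have tT : K * (t + 2 * m) `^ (p - 1) * N <= K * Q * N.
  by rewrite ler_wpM2r// ler_wpM2l// Qt//; lra.
have {}large : A <= Mp / 4 + 2 * c2 * (N * (K * Q)).
  apply: le_trans large _.
  have KtM : K / t * Mp <= (8 * c2)^-1 * Mp by rewrite ler_wpM2r.
  have cc : c2 * ((8 * c2)^-1 * Mp) = Mp / 8 by field; lra.
  have K_t0 : 0 <= K / t by rewrite divr_ge0// ltW.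
  have := ler_wpM2l K_t0 shift; have c20 : 0 <= c2 by lra.
  have := ler_wpM2l c20 KtM; have := ler_wpM2l c20 KtN; rewrite cc.
  rewrite -(mulrA 2); move: (K / t) => Kt'.
  by lra.
have KQN : K * Q * N <= (11 * c2) `^ (p - 1) * Num.max K (K `^ p) * N.
  by rewrite ler_wpM2r.
have KQN0 : 0 <= K * Q * N by rewrite !mulr_ge0.
(* Absorbing [Mp / 4] leaves [3/4 Mp <= (2 c2 + 1) K Q N <= 3 c2 K Q N]. *)
apply: (@le_trans _ _ (4 * c2 * (K * Q * N))).
  have : 1 * (K * Q * N) <= c2 * (K * Q * N) by rewrite ler_wpM2r.
  move: small; rewrite -/N (_ : _ * (K * d%:R * _) =
    K * (t + 2 * m) `^ (p - 1) * N); last by rewrite /N; ring.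
  by lra.
by rewrite -!mulrA in KQN *; rewrite ler_wpM2l// ler_wpM2l//; lra.
Qed.

(** When [K^p] is the maximum, a linear lower bound for the power transfers the l^1 estimate. When
    [K] is the maximum, integrality suffices, as a natural number is at most its [p]-th power. *)
Lemma moment_ge :
  (1 / 800) `^ p * Num.max K (K `^ p) * (d%:R * #|` S|%:R) <= Mp.
Proof.
have K0 := kappa_ge0; set N := d%:R * #|` S|%:R.
have N0 : 0 <= N by rewrite mulr_ge0.
have l1 : K * N / 400 <= \sum_(x <- S) \sum_i `|x 0 i|.
  by rewrite /N mulrA; exact: sum_l1_ge.
case: (leP K (K `^ p)) => Kp.
  pose l := K / 800; have l0 : 0 <= l by rewrite /l; lra.
  have c0 : 0 <= 1 / 800 :> R by lra.
  rewrite -(powRM _ c0 K0) (_ : 1 / 800 * K = l); last by rewrite /l; lra.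
  (* A substitute for Jensen: [a `^ p >= l `^ (p - 1) * (a - l)], with [l] half
     of the lower bound on the mean. *)
  apply: (@le_trans _ _ (l `^ (p - 1) * (\sum_(x <- S) \sum_i (`|x 0 i| - l)))).
    rewrite -(mulr_powRB1 l0 p_gt0) mulrAC mulrC ler_wpM2l ?powR_ge0//.
    rewrite (eq_bigr (fun x => \sum_i `|x 0 i| - d%:R * l)) => [|x _]; last first.
      by rewrite sumrB sumr_const card_ord mulr_natl.
    rewrite sumrB big_const_seq count_predT iter_addr_0 -[X in _ - X]mulr_natl.
    have -> : #|` S|%:R * (d%:R * l) = l * N by rewrite /N mulrA mulrC (mulrC d%:R).
    by move: l1; rewrite (_ : K * N / 400 = 2 * (l * N)); [lra|rewrite /l; field].
  rewrite mulr_sumr; apply: ler_sum => x _.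
  rewrite mulr_sumr; apply: ler_sum => i _.
  have [lx|xl] := leP l `|x 0 i|.
    rewrite -(mulr_powRB1 (normr_ge0 _) p_gt0) mulrC.
    apply: ler_pM; rewrite ?powR_ge0 ?subr_ge0//; first by rewrite gerBl.
    by apply: ge0_ler_powR; rewrite // ?nnegrE.
  rewrite (le_trans _ (powR_ge0 _ _))// mulr_ge0_le0 ?powR_ge0//.
  by rewrite subr_le0 ltW.
apply: (@le_trans _ _ (K * N / 400)).
  have : (1 / 800) `^ p <= 1 / 800 :> R by apply: ge1r_powR p_ge1; lra.
  move/(ler_wpM2r (mulr_ge0 K0 N0)); have := mulr_ge0 K0 N0.
  by rewrite mulrA; lra.
apply: le_trans l1 _; rewrite big_seq [leRHS]big_seq; apply: ler_sum => x xS.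
apply: ler_sum => i _; rewrite -(nabsE symG x i xS).
have [->|n0] := posnP (nabs x i); first exact: powR_ge0.
by apply: le1r_powR; rewrite // ler1n.
Qed.

End Moments.

(** * From moment sums to lattice averages *)

Theorem theorem1p2 (R : realType) (p : R) (hp : 1 <= p) :
  exists c C : R, [/\ 0 < c, c <= C &
    forall (d : nat) (hd : (0 < d)%N) (G : set 'rV[R]_d), sym_body G ->
      let avg := lattice_avg G (fun x => `|x 0 (Ordinal hd)| `^ p) in
      let M := Num.max (kappa G) (kappa G `^ p) in
      avg = lattice_avg G (fun x => pnorm p x `^ p / d%:R) /\
      c * M <= avg <= C * M].
Proof.
have p_gt0 : 0 < p by exact: lt_le_trans hp.
exists ((1 / 800) `^ p), (4 * 2 `^ p * (11 * 2 `^ p) `^ (p - 1)); split.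
- by apply: powR_gt0; lra.
(* The lower constant is at most 1/800, while every factor of the upper one is at least 1. *)
- have p2 : 1 <= 2 `^ p :> R by apply: le_trans (le1r_powR _ hp); lra.
  have q1 : 1 <= (11 * 2 `^ p) `^ (p - 1) :> R.
    have p1 : 0 <= p - 1 by rewrite subr_ge0.
    have c1 : 1 <= 11 * 2 `^ p :> R by lra.
    by have := ler_powR c1 p1; rewrite powRr0.
  have c1 : (1 / 800) `^ p <= 1 / 800 :> R.
    by apply: ge1r_powR hp; lra.
  by nra.
move=> d hd G symG avg M.
have dR : 0 < d%:R :> R by rewrite ltr0n.
have SR : 0 < #|` lattice_points G|%:R :> R.
  by rewrite ltr0n (card_lattice_gt0 symG).
have coord : d%:R * \sum_(x <- lattice_points G) `|x 0 (Ordinal hd)| `^ p =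
    \sum_(x <- lattice_points G) \sum_i `|x 0 i| `^ p.
  by rewrite (sum_coord symG (fun r => `|r| `^ p) (Ordinal hd))//
    => r; exact: powR_ge0.
have pnormE (x : 'rV[R]_d) : pnorm p x `^ p = \sum_i `|x 0 i| `^ p.
  rewrite /pnorm -powRrM mulVf ?gt_eqF// powRr1//.
  by apply: sumr_ge0 => i _; exact: powR_ge0.
(* By coordinate symmetry, multiplying the average by [d |S|] gives the full moment sum, to which
   [moment_ge] and [moment_le] apply. *)
have avgE : avg * (d%:R * #|` lattice_points G|%:R) =
    \sum_(x <- lattice_points G) \sum_i `|x 0 i| `^ p.
  by rewrite -coord /avg /lattice_avg mulrC -mulrA mulVKf ?gt_eqF.
split.
  rewrite /avg /lattice_avg; congr (_ * _).
  under [RHS]eq_bigr do rewrite pnormE.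
  by rewrite -mulr_suml -coord mulrAC divff ?mul1r// gt_eqF.
have NR := mulr_gt0 dR SR.
rewrite -(ler_pM2r NR) -[X in _ && X](ler_pM2r NR) avgE.
by rewrite (moment_ge symG hd p hp) (moment_le symG hd p hp).
Qed.
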